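(* Let $G$ be a simple graph, let $k,u,v,c,k_1,k_2\in\mathbb{Z}$ and $d,m,n\in\mathbb{Z}^+$. In each of the following, assume that the quantity (or quantities) on the right-hand side exist. (1) If $[u]$ is a unit in $\mathbb{Z}_n$, then $\chi_{(n,uk)}(G) = \chi_{(n,k)}(G)$. (2) $\chi_{(n,vk)}(G) \leq \chi_{(n,k)}(G)$. (3) If $d$ is a common divisor of $k$ and $n$, then $\chi_{(n,k)}(G) \leq \chi_{(n/d,\, k/d)}(G)$. (4) If $m$ divides $n$, then $\chi_{(m, k)}(G) \leq \chi_{(n,k)}(G)$. (5) If $G$ admits a constant labeling that is an open coloring with remainder $c \bmod n$, then $\chi_{(n,k - c)}(G) = \chi_{(n,k)}(G)$. (6) $\chi_{(n,k_1+k_2)}(G) \leq \chi_{(n,k_1)}(G)\, \chi_{(n,k_2)}(G)$.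
   Context: For a graph $G=(V,E)$, a $\mathbb{Z}$-labeling is a map $\ell:V\to\mathbb{Z}$; its order is the size of its range; it is proper if adjacent vertices get different labels; $\chi(G)$ is the minimum order of a proper labeling. $N(v)$ is the open neighborhood of $v$ (its neighbors, excluding $v$). For $k\in\mathbb{Z}$, $n\in\mathbb{Z}^+$, an open coloring with remainder $k \bmod n$ is a labeling with $\sum_{w\in N(v)}\ell(w)\equiv k \pmod n$ for all $v\in V$. If no proper such coloring exists, $\chi_{(n,k)}(G)$ does not exist; if proper such colorings of finite order exist, $\chi_{(n,k)}(G)$ is the minimum order of one; if they exist only of infinite order, $\chi_{(n,k)}(G)=\infty$. $[u]$ denotes the image of $u$ in $\mathbb{Z}_n$. *)

(* Defs.v *)
From HB Require Import structures.
From mathcomp Require Import all_boot all_order all_algebra.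
From mathcomp Require Import finmap.
From mathcomp Require Import mathcomp_extra boolp classical_sets functions.
From mathcomp Require Import cardinality fsbigop constructive_ereal.

Set Implicit Arguments.
Unset Strict Implicit.
Unset Printing Implicit Defensive.

Import Order.TTheory GRing.Theory Num.Theory.
Local Open Scope classical_set_scope.
Local Open Scope ring_scope.

(* Possibly infinite; no degree bound is imposed. *)
Record simple_graph := SimpleGraph {
  vertex :> choiceType;
  adj : rel vertex;
  adj_sym : symmetric adj;
  adj_irrefl : irreflexive adj }.

Definition open_nbhd (G : simple_graph) (v : G) : set G := [set w | adj v w].

Definition order_of (V : Type) (l : V -> int) : \bar int :=
  if pselect (finite_set (range l)) then #|` fset_set (range l)|%:Z%:E
  else +oo%E.

Definition proper (G : simple_graph) (l : G -> int) : Prop :=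
  forall v w : G, adj v w -> l v != l w.

(* The first conjunct says that the sum over the neighborhood has finitely many
   nonzero terms, hence is meaningful (otherwise \sum_(w \in _) is 0 by
   convention). It holds automatically when G is locally finite. *)
Definition open_coloring (G : simple_graph) (n : nat) (k : int) (l : G -> int)
    : Prop :=
  forall v : G,
    finite_set (open_nbhd v `&` [set w | l w != 0]) /\
    (\sum_(w \in open_nbhd v) l w = k %[mod n%:Z])%Z.

Definition proper_open_coloring (G : simple_graph) (n : nat) (k : int)
    : set (G -> int) :=
  [set l | proper l /\ open_coloring n k l].
Arguments proper_open_coloring : clear implicits.

Definition is_minimum (S : set (\bar int)) (x : \bar int) : Prop :=
  S x /\ forall y, S y -> (x <= y)%E.

(* None: the number does not exist; Some +oo: all the proper open colorings
   have infinite order. The default +oo of xget is never used, since a nonempty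
   set of orders has a minimum. *)
Definition open_chi (G : simple_graph) (n : nat) (k : int)
    : option (\bar int) :=
  if pselect (proper_open_coloring G n k !=set0) then
    Some (xget +oo%E
      [set x | is_minimum [set order_of l | l in proper_open_coloring G n k] x])
  else None.

(* The class of u is a unit of Z/n; unlike 'Z_n, this is also right for n = 1. *)
Definition unit_mod (n : nat) (u : int) : Prop :=
  exists w : int, (u * w = 1 %[mod n%:Z])%Z.

(* Main.v *)
(* Every part maps one or two proper open colorings, label by label, to another:
   if phi(0, 0) = 0 and phi(a, b) = p a + q b mod n, then phi(l1, l2) is an open
   coloring with remainder p k1 + q k2 mod n, and phi(0, 0) = 0 keeps the
   neighborhood sums finite. Its order is at most the product of the two orders.
   Part (6) uses a phi that is injective on Z x Z and congruent to a + b mod n, so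
   that it also covers two labelings of infinite order. *)
Require Import Defs.
From HB Require Import structures.
From mathcomp Require Import all_boot all_order all_algebra.
From mathcomp Require Import finmap.
From mathcomp Require Import mathcomp_extra boolp classical_sets functions.
From mathcomp Require Import cardinality fsbigop constructive_ereal.
Import Order.TTheory GRing.Theory Num.Theory.
Local Open Scope ring_scope.

Set Implicit Arguments.
Unset Strict Implicit.

(** * Orders of labelings *)

Lemma order_of_finite {V : Type} (l : V -> int) : finite_set (range l) ->
  order_of l = #|` fset_set (range l)|%:Z%:E.
Proof. by rewrite /order_of; case: pselect. Qed.

Lemma order_of_infinite {V : Type} (l : V -> int) : ~ finite_set (range l) ->
  order_of l = +oo%E.
Proof. by rewrite /order_of; case: pselect. Qed.

Lemma order_of_le_size {V : Type} (l : V -> int) (s : seq int) :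
  (forall v, l v \in s) -> (order_of l <= (size s)%:Z%:E)%E.
Proof.
move=> ls; have finl : finite_set (range l).
  by apply: sub_finite_set (finite_seq s) => _ [v _ <-]; exact: ls.
rewrite order_of_finite// lee_fin lez_nat uniq_leq_size ?fset_uniq// => x.
by rewrite in_fset_set// inE => -[v _ <-].
Qed.

Lemma mem_fset_range {V : Type} (l : V -> int) (v : V) :
  finite_set (range l) -> l v \in fset_set (range l).
Proof. by move=> finl; rewrite in_fset_set// inE; exists v. Qed.

Lemma order_of_comp {V : Type} (g : int -> int) (l : V -> int) :
  (order_of (g \o l) <= order_of l)%E.
Proof.
have [finl|/order_of_infinite->] := pselect (finite_set (range l)); last first.
  by rewrite leey.
rewrite [leRHS]order_of_finite// -(size_map g).
by apply: order_of_le_size => v; rewrite map_f// mem_fset_range.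
Qed.

Lemma order_of_gt0 {V : Type} (x : V) (l : V -> int) : (0 < order_of l)%E.
Proof.
have [finl|/order_of_infinite->] := pselect (finite_set (range l)); last first.
  by rewrite lt0y.
rewrite order_of_finite// lte_fin ltz_nat cardfs_gt0; apply/fset0Pn.
by exists (l x); apply: mem_fset_range.
Qed.

Lemma order_of_pair {V : Type} (phi : int -> int -> int) (f g : V -> int) :
  (order_of (fun v => phi (f v) (g v)) <= order_of f * order_of g)%E.
Proof.
(* With no vertices every order is 0. Otherwise both orders are positive, so one infinite factor
   already makes the product [+oo], with no product of 0 and [+oo] to consider. *)
have [[x]|V0] := pselect (inhabited V); last first.
  have order0 (h : V -> int) : order_of h = 0%E.
    have rh : (range h = set0)%classic by rewrite -subset0 => y [v]; case: V0.
    have finh : finite_set (range h) by rewrite rh.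
    by rewrite (order_of_finite finh) rh fset_set0 cardfs0.
  by rewrite !order0 mul0e.
have [finf|/order_of_infinite->] := pselect (finite_set (range f)); last first.
  by rewrite gt0_mulye ?leey ?(order_of_gt0 x).
have [fing|/order_of_infinite->] := pselect (finite_set (range g)); last first.
  by rewrite gt0_muley ?leey ?(order_of_gt0 x).
rewrite (order_of_finite finf) (order_of_finite fing) -EFinM -PoszM.
rewrite -(size_allpairs phi); apply: order_of_le_size => v.
by rewrite allpairs_f// mem_fset_range.
Qed.

(** * The open chromatic number as an attained minimum *)

Lemma order_of_minimum {V : Type} (S : set (V -> int)) : (S !=set0)%classic ->
  exists x, is_minimum [set order_of l | l in S]%classic x.
Proof.
move=> [l0 Sl0].
have [[l Sl finl]|allinf] := pselect (exists2 l, S l & finite_set (range l)).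
  (* The finite orders are natural numbers, so well-ordering gives a least one; it lies below [+oo]
     as well. If no order is finite, the only value is [+oo]. *)
  pose P n := `[< exists2 l, S l & order_of l = n%:Z%:E >].
  have exP : exists n, P n.
    by exists #|` fset_set (range l)|; apply/asboolP; exists l; rewrite ?order_of_finite.
  case: (ex_minnP exP) => n /asboolP[l1 Sl1 l1n] min_n.
  exists n%:Z%:E; split=> [|_ [l2 Sl2 <-]]; first by exists l1.
  have [finl2|/order_of_infinite->] := pselect (finite_set (range l2)); last first.
    by rewrite leey.
  rewrite order_of_finite// lee_fin lez_nat min_n//.
  by apply/asboolP; exists l2; rewrite ?order_of_finite.
exists +oo%E; split=> [|_ [l Sl <-]].
  by exists l0 => //; apply: order_of_infinite => fin0; apply: allinf; exists l0.
by rewrite order_of_infinite// => finl; apply: allinf; exists l.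
Qed.

Lemma open_chi_minimum {G : simple_graph} {n : nat} {k : int} {x : \bar int} :
  open_chi G n k = Some x ->
  is_minimum [set order_of l | l in proper_open_coloring G n k]%classic x.
Proof.
rewrite /open_chi; case: pselect => // ne [<-].
exact: (@xgetPex _ +oo%E _ (order_of_minimum ne)).
Qed.

Lemma open_chi_le {G : simple_graph} {n : nat} {k : int} {l : G -> int} :
  proper_open_coloring G n k l ->
  exists2 y, open_chi G n k = Some y & (y <= order_of l)%E.
Proof.
move=> lP; case E : (open_chi G n k) => [y|]; last first.
  by move: E; rewrite /open_chi; case: pselect => // -[]; exists l.
by exists y => //; apply: (open_chi_minimum E).2; exists l.
Qed.

(** The minimum is attained, so it is enough to transform one minimizing coloring; its image also
    shows that the second number exists. *)
Lemma open_chi_mono {G : simple_graph} {n n' : nat} {k k' : int} :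
  (forall l, proper_open_coloring G n k l ->
     exists2 l', proper_open_coloring G n' k' l' &
       (order_of l' <= order_of l)%E) ->
  forall x, open_chi G n k = Some x ->
    exists2 y, open_chi G n' k' = Some y & (y <= x)%E.
Proof.
move=> tr x /open_chi_minimum[[l /tr[l' l'P le_l'l] <-] _].
by have [y ? /le_trans le_y] := open_chi_le l'P; exists y => //; apply: le_y.
Qed.

(** Serves the two equalities of the theorem: each comes from a transformation of colorings together
    with one that undoes it. *)
Lemma open_chi_antisym {G : simple_graph} {n n' : nat} {k k' : int} :
  (forall x, open_chi G n k = Some x ->
    exists2 y, open_chi G n' k' = Some y & (y <= x)%E) ->
  (forall x, open_chi G n' k' = Some x ->
    exists2 y, open_chi G n k = Some y & (y <= x)%E) ->
  forall x, open_chi G n k = Some x -> open_chi G n' k' = Some x.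
Proof.
move=> le1 le2 x kx; have [y k'y yx] := le1 x kx; have [z] := le2 y k'y.
by rewrite kx => -[<-] xy; rewrite k'y; congr Some; apply: le_anti; rewrite yx.
Qed.

(** * Linear combinations of open colorings *)

Lemma fsum_comb_mod {T : choiceType} (A : set T) (n p q : int)
    (phi : int -> int -> int) (f g : T -> int) :
  phi 0 0 = 0 -> (forall a b, phi a b = p * a + q * b %[mod n])%Z ->
  finite_set (A `&` [set w | f w != 0])%classic ->
  finite_set (A `&` [set w | g w != 0])%classic ->
  finite_set (A `&` [set w | phi (f w) (g w) != 0])%classic /\
  (\sum_(w \in A) phi (f w) (g w) =
   p * (\sum_(w \in A) f w) + q * (\sum_(w \in A) g w) %[mod n])%Z.
Proof.
move=> phi0 phiE finf fing.
(* Off [B] both functions vanish, and by [phi0] so does their image under [phi]; hence all three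
   sums reduce to the finite set [B]. *)
pose B := (A `&` [set w | f w != 0] `|` A `&` [set w | g w != 0])%classic.
have finB : finite_set B by rewrite finite_setU.
have out w : (A `\` B)%classic w -> f w = 0 /\ g w = 0.
  move=> [Aw nBw]; split; apply/eqP/negPn/negP => nz; apply: nBw.
    by left.
  by right.
have BA : (B `<=` A)%classic by move=> w [[]|[]].
have phi_out w : (A `\` B)%classic w -> phi (f w) (g w) = 0.
  by move=> /out[-> ->].
split.
  apply: sub_finite_set finB => w [Aw /= nz]; apply: contrapT => nBw.
  by rewrite phi_out ?eqxx in nz.
have sumB (h : T -> int) : (forall w, (A `\` B)%classic w -> h w = 0) ->
    \sum_(w \in A) h w = \sum_(w <- fset_set B) h w.
  by move=> h0; rewrite -(fsbig_widen _ _ _ BA)// fsbig_finite.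
rewrite !sumB//; try by move=> w /out[].
(* The difference of the two sides is a sum over [B] of terms divisible by [n]. *)
apply/eqP; rewrite eqz_mod_dvd !mulr_sumr -big_split -sumrB /=.
by apply: rpred_sum => w _; rewrite -eqz_mod_dvd; apply/eqP.
Qed.

Lemma open_coloring_comb {G : simple_graph} (n : nat) (k1 k2 p q : int)
    (phi : int -> int -> int) (l1 l2 : G -> int) :
  phi 0 0 = 0 -> (forall a b, phi a b = p * a + q * b %[mod n])%Z ->
  open_coloring n k1 l1 -> open_coloring n k2 l2 ->
  open_coloring n (p * k1 + q * k2) (fun v => phi (l1 v) (l2 v)).
Proof.
move=> phi0 phiE l1P l2P v; have [fin1 s1] := l1P v; have [fin2 s2] := l2P v.
have [? ->] := fsum_comb_mod phi0 phiE fin1 fin2; split=> //.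
by rewrite -modzDm -modzMmr s1 -[(q * _ %% _)%Z]modzMmr s2 !modzMmr modzDm.
Qed.

Lemma open_coloring_scale {G : simple_graph} (n d : nat) (k : int)
    (l : G -> int) : open_coloring n k l ->
  open_coloring (n * d) (d%:Z * k) (fun v => d%:Z * l v).
Proof.
move=> lP v; have [fin s] := lP v.
(* Congruence modulo 0 is equality, so [sE] is the exact identity pulling [d] out of the sum. A
   congruence mod [n] multiplied by [d] then holds mod [n * d]. *)
have [|a b|? sE] := @fsum_comb_mod _ (open_nbhd v) 0 d%:Z 0 (fun a _ => d%:Z * a) l l _ _ fin fin.
- exact: mulr0.
- by rewrite mul0r addr0.
split=> //; move: sE; rewrite !modz0 mul0r addr0 => ->.
apply/eqP; rewrite eqz_mod_dvd -mulrBr PoszM [(n%:Z * _)]mulrC.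
by rewrite dvdz_mul// -eqz_mod_dvd; apply/eqP.
Qed.

(** * Transformations behind the six statements *)

Lemma proper_comp {G : simple_graph} (g : int -> int) (l : G -> int) :
  injective g -> Defs.proper l -> Defs.proper (fun v => g (l v)).
Proof. by move=> g_inj lP v w vw; rewrite (inj_eq g_inj) lP. Qed.

Lemma open_chi_mulr {G : simple_graph} (n : nat) (k v : int) : (0 < n)%N ->
  forall x, open_chi G n k = Some x ->
    exists2 y, open_chi G n (v * k) = Some y & (y <= x)%E.
Proof.
move=> n_gt0; apply: open_chi_mono => l [lproper lP].
(* If v = 0, multiplying by n instead keeps the labeling proper. *)
have [v' v'0 v'v] : exists2 v' : int, v' != 0 & (v' = v %[mod n%:Z])%Z.
  have [->|] := eqVneq v 0; last by exists v.
  by exists n%:Z; rewrite ?modzz ?mod0z// -lt0n.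
exists (fun w => v' * l w); last exact: (order_of_comp ( *%R v')).
split; first exact: proper_comp (mulfI v'0) lproper.
(* A map of one labeling is a combination with second coefficient 0. The coefficient is [v] although
   the factor is [v'], since only its class mod [n] matters. *)
have := @open_coloring_comb G n k k v 0 (fun a _ => v' * a) l l (mulr0 _) _ lP lP.
rewrite mul0r addr0; apply=> a b.
by rewrite mul0r addr0 -modzMml v'v modzMml.
Qed.

Lemma open_coloring_eqmod {G : simple_graph} {n : nat} {k k' : int}
    {l : G -> int} : (k = k' %[mod n%:Z])%Z ->
  open_coloring n k l -> open_coloring n k' l.
Proof. by move=> kk' lP v; rewrite -kk'. Qed.

Lemma open_chi_eqmod {G : simple_graph} {n : nat} {k k' : int} :
  (k = k' %[mod n%:Z])%Z -> open_chi G n k = open_chi G n k'.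
Proof.
move=> kk'; rewrite /open_chi.
suff -> : proper_open_coloring G n k = proper_open_coloring G n k' by [].
by apply/seteqP; split=> l [? lP]; split=> //; apply: open_coloring_eqmod lP.
Qed.

Lemma open_chi_unit {G : simple_graph} (n : nat) (k u : int) : (0 < n)%N ->
  unit_mod n u ->
  forall x, open_chi G n k = Some x -> open_chi G n (u * k) = Some x.
Proof.
move=> n_gt0 [w uw]; apply: open_chi_antisym; first exact: open_chi_mulr.
(* As [w * u] is 1 mod [n], multiplication by [w] undoes multiplication by [u] and gives the reverse
   inequality. *)
have -> : open_chi G n k = open_chi G n (w * (u * k)).
  by apply: open_chi_eqmod; rewrite mulrA -modzMml [w * u]mulrC uw modzMml mul1r.
exact: open_chi_mulr.
Qed.

Lemma open_chi_divn {G : simple_graph} (n d : nat) (k : int) : (0 < d)%N ->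
  (d %| k)%Z -> (d %| n)%N ->
  forall x, open_chi G (n %/ d)%N (k %/ d)%Z = Some x ->
    exists2 y, open_chi G n k = Some y & (y <= x)%E.
Proof.
move=> d_gt0 dk dn; apply: open_chi_mono => l [lproper lP].
exists (fun w => d%:Z * l w); last exact: (order_of_comp ( *%R d%:Z)).
have d0 : d%:Z != 0 by rewrite -lt0n.
split; first exact: proper_comp (mulfI d0) lproper.
by have := open_coloring_scale d lP; rewrite divnK// mulrC divzK.
Qed.

Lemma open_chi_dvdn {G : simple_graph} (n m : nat) (k : int) : (m %| n)%N ->
  forall x, open_chi G n k = Some x ->
    exists2 y, open_chi G m k = Some y & (y <= x)%E.
Proof.
move=> mn; apply: open_chi_mono => l [lproper lP]; exists l => //; split=> // v.
have [fin /eqP s] := lP v; split=> //; apply/eqP; move: s.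
by rewrite !eqz_mod_dvd; apply: dvdz_trans.
Qed.

(** Adding [e] times the constant is a translation, hence keeps properness. The values [e = -1] and
    [e = 1] give the two directions of the equality. If [a] is nonzero, [aP] forces every
    neighborhood to be finite, so the translated sums are meaningful. *)
Lemma open_chi_const_le {G : simple_graph} (n : nat) (k c a e : int) :
  open_coloring n c (fun _ : G => a) ->
  forall x, open_chi G n k = Some x ->
    exists2 y, open_chi G n (k + e * c) = Some y & (y <= x)%E.
Proof.
move=> aP; apply: open_chi_mono => l [lproper lP].
exists (fun w => l w + e * a); last exact: (order_of_comp (+%R^~ (e * a))).
split; first exact: (proper_comp (g := +%R^~ (e * a)) (@addIr _ _) lproper).
have := @open_coloring_comb G n k c 1 e (fun b a => b + e * a) l _ _ _ lP aP.
by rewrite mul1r; apply=> [|b b']; rewrite ?mulr0 ?addr0 ?mul1r.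
Qed.

Lemma open_chi_const {G : simple_graph} (n : nat) (k c a : int) :
  open_coloring n c (fun _ : G => a) ->
  forall x, open_chi G n k = Some x -> open_chi G n (k - c) = Some x.
Proof.
move=> aP; apply: open_chi_antisym.
  by rewrite -mulN1r; apply: open_chi_const_le aP.
by have := open_chi_const_le (k := k - c) 1 aP; rewrite mul1r subrK.
Qed.

(** Quotient and remainder by [n] are chosen independently: the remainder is that of [a + b], and
    the quotient is an injective code of the pair, shifted to vanish at (0, 0). *)
Lemma injective_pairing_mod (n : nat) : (0 < n)%N ->
  exists phi : int -> int -> int,
    [/\ phi 0 0 = 0, (forall a b, phi a b = a + b %[mod n%:Z])%Z &
        forall a b a' b', phi a b = phi a' b' -> a = a' /\ b = b'].
Proof.
move=> n_gt0; have n0 : n%:Z != 0 by rewrite -lt0n.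
pose code (a b : int) : int := (choice.pickle (a, b))%:Z - (choice.pickle (0 : int, 0 : int))%:Z.
exists (fun a b => code a b * n%:Z + ((a + b)%R %% n%:Z)%Z).
split=> [|a b|a b a' b' eq_phi].
- by rewrite /code subrr mul0r addr0 mod0z addr0.
- by rewrite modzMDl modz_mod.
(* Division by [n] discards the remainder and leaves an equality of codes. *)
have /(congr1 (divz^~ n%:Z)) := eq_phi.
rewrite !divzMDl// !divz_small ?modz_ge0 ?ltz_pmod// ?addr0.
by move=> /addIr[] /(pcan_inj choice.pickleK)[].
Qed.

Lemma open_chi_add {G : simple_graph} (n : nat) (k1 k2 : int) : (0 < n)%N ->
  forall x1 x2, open_chi G n k1 = Some x1 -> open_chi G n k2 = Some x2 ->
    exists2 y, open_chi G n (k1 + k2) = Some y & (y <= x1 * x2)%E.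
Proof.
move=> n_gt0 x1 x2 /open_chi_minimum[[l1 [l1proper l1P] <-] _].
move=> /open_chi_minimum[[l2 [_ l2P] <-] _].
have [phi [phi0 phiE phi_inj]] := injective_pairing_mod n_gt0.
have lP : proper_open_coloring G n (k1 + k2) (fun v => phi (l1 v) (l2 v)).
  split=> [v w vw|].
    (* Equal values of [phi] at adjacent vertices would force equal values of [l1]. *)
    by apply: contra_neq (l1proper _ _ vw) => /phi_inj[].
  have := @open_coloring_comb G n k1 k2 1 1 phi l1 l2 phi0 _ l1P l2P.
  by rewrite !mul1r; apply=> a b; rewrite !mul1r.
have [y ? /le_trans le_y] := open_chi_le lP; exists y => //; apply: le_y.
exact: order_of_pair.
Qed.

Theorem theorem5p3 (G : simple_graph) (k u v c k1 k2 : int) (d m n : nat)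
    (d_gt0 : (0 < d)%N) (m_gt0 : (0 < m)%N) (n_gt0 : (0 < n)%N) :
  (unit_mod n u -> forall x : \bar int,
     open_chi G n k = Some x -> open_chi G n (u * k) = Some x) /\
  (forall x : \bar int, open_chi G n k = Some x ->
     exists2 y : \bar int, open_chi G n (v * k) = Some y & (y <= x)%E) /\
  ((d %| k)%Z -> (d %| n)%N -> forall x : \bar int,
     open_chi G (n %/ d)%N (k %/ d)%Z = Some x ->
     exists2 y : \bar int, open_chi G n k = Some y & (y <= x)%E) /\
  ((m %| n)%N -> forall x : \bar int, open_chi G n k = Some x ->
     exists2 y : \bar int, open_chi G m k = Some y & (y <= x)%E) /\
  ((exists a : int, open_coloring n c (fun _ : G => a)) ->
     forall x : \bar int,
     open_chi G n k = Some x -> open_chi G n (k - c) = Some x) /\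
  (forall x1 x2 : \bar int,
     open_chi G n k1 = Some x1 -> open_chi G n k2 = Some x2 ->
     exists2 y : \bar int,
       open_chi G n (k1 + k2) = Some y & (y <= x1 * x2)%E).
Proof.
split; first exact: open_chi_unit.
split; first exact: open_chi_mulr.
split; first exact: open_chi_divn.
split; first exact: open_chi_dvdn.
split; first by move=> [a]; apply: open_chi_const.
exact: open_chi_add.
Qed.
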